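(* There is an algorithm that, given a quantified Boolean formula $\psi = Q_1 x_1 \cdots Q_n x_n\, \varphi$ with $Q_i \in \{\exists,\forall\}$ and $\varphi$ a CNF formula over $x_1,\dots,x_n$ in which every variable has degree at most $2$ (i.e. appears in at most two clauses), determines the winner of the QBF game played on $\psi$ in time quadratic in the size of $\psi$.
   Context: The QBF game on $\psi = Q_1 x_1 \cdots Q_n x_n\,\varphi$ is played by Satisfier and Falsifier: for $i=1$ to $n$, if $Q_i=\exists$ Satisfier assigns a truth value to $x_i$, and if $Q_i=\forall$ Falsifier assigns a truth value to $x_i$. At the end, Satisfier wins iff the resulting valuation satisfies $\varphi$ (equivalently, iff $\psi$ is true). The degree $d(x)$ of a variable $x$ in a CNF formula is the number of clauses in which $x$ appears (complemented or not). *)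

(* Defs.v *)
From mathcomp Require Import all_boot.
Set Implicit Arguments. Unset Strict Implicit. Unset Printing Implicit Defensive.

(* A literal is (i, b): variable x_{i+1} (0-based index i), b = true means the
   positive literal x_{i+1}, b = false the complemented literal. *)
Definition literal := (nat * bool)%type.
Definition clause := seq literal.
Definition cnf := seq clause.

Definition eval_lit (rho : nat -> bool) (l : literal) : bool :=
  if l.2 then rho l.1 else ~~ rho l.1.

Definition eval_cnf (rho : nat -> bool) (phi : cnf) : bool :=
  all (fun C => has (eval_lit rho) C) phi.

(* Quantifier prefix: qs = [:: Q_1; ...; Q_n], with true = exists, false = forall. *)

(* The QBF game: variables are assigned in order x_1, ..., x_n; the player
   owning Q_i (Satisfier for exists, Falsifier for forall) chooses x_i.
   [sat_wins_from qs prefix phi] = Satisfier wins (under optimal play of both)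
   from the position where x_1..x_{size prefix} are set to [prefix] and the
   remaining quantifiers are [qs]. *)
Fixpoint sat_wins_from (qs : seq bool) (prefix : seq bool) (phi : cnf) : bool :=
  match qs with
  | [::] => eval_cnf (fun v => nth false prefix v) phi
  | q :: qs' =>
      if q then sat_wins_from qs' (rcons prefix true) phi
                || sat_wins_from qs' (rcons prefix false) phi
      else sat_wins_from qs' (rcons prefix true) phi
           && sat_wins_from qs' (rcons prefix false) phi
  end.

Definition satisfier_wins (qs : seq bool) (phi : cnf) : bool :=
  sat_wins_from qs [::] phi.

Definition wf_qbf (qs : seq bool) (phi : cnf) : Prop :=
  forall C, C \in phi -> forall l, l \in C -> l.1 < size qs.

Definition degree (phi : cnf) (v : nat) : nat :=
  count (fun C => has (fun l : literal => l.1 == v) C) phi.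

Definition qbf_size (qs : seq bool) (phi : cnf) : nat :=
  size qs + size phi + sumn (map size phi).

Definition encode_lit (l : literal) : nat := 2 * l.1 + ~~ l.2.

Definition encode (qs : seq bool) (phi : cnf) : seq nat :=
  size qs :: map nat_of_bool qs ++
  size phi :: flatten (map (fun C => size C :: map encode_lit C) phi).

Inductive instr : Type :=
| IConst of nat & nat        (* IConst r c   : R[r] := c               *)
| IAdd of nat & nat & nat    (* IAdd r a b   : R[r] := R[a] + R[b]     *)
| ISub of nat & nat & nat    (* ISub r a b   : R[r] := R[a] - R[b] (truncated) *)
| ILoad of nat & nat         (* ILoad r a    : R[r] := R[R[a]]         *)
| IStore of nat & nat        (* IStore a r   : R[R[a]] := R[r]         *)
| IJz of nat & nat           (* IJz r l      : if R[r] = 0 goto l else next *)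
| IHalt.

Definition program := seq instr.

Record config := Config { pc : nat; regs : nat -> nat }.

Definition upd (m : nat -> nat) (r v : nat) : nat -> nat :=
  fun i => if i == r then v else m i.

(* the current instruction; a pc outside the program acts as IHalt *)
Definition cur (p : program) (c : config) : instr := nth IHalt p (pc c).

Definition halted (p : program) (c : config) : bool :=
  if cur p c is IHalt then true else false.

Definition step (p : program) (c : config) : config :=
  let m := regs c in
  let n := (pc c).+1 in
  match cur p c with
  | IConst r k => Config n (upd m r k)
  | IAdd r a b => Config n (upd m r (m a + m b))
  | ISub r a b => Config n (upd m r (m a - m b))
  | ILoad r a => Config n (upd m r (m (m a)))
  | IStore a r => Config n (upd m (m a) (m r))
  | IJz r l => Config (if m r == 0 then l else n) m
  | IHalt => c
  end.

Definition run (p : program) (t : nat) (c : config) : config := iter t (step p) c.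

Definition init (w : seq nat) : config :=
  Config 0 (fun i => if i == 0 then size w else nth 0 w i.-1).

(* Main.v *)
Require Import Defs.
From mathcomp Require Import all_boot zify.
Set Implicit Arguments. Unset Strict Implicit. Unset Printing Implicit Defensive.

(** Eliminate the variables from the innermost quantifier outwards. A clause
    containing both polarities of the variable is dropped. A universal variable
    is then simply erased from the other clauses. For an existential variable,
    occurring in at most two clauses, either it can be set so as to satisfy
    every clause containing it, and these are dropped, or it occurs in exactly
    two clauses with opposite polarities, and these are replaced by their
    resolvent. Since a resolvent is a union of clauses, the formula never has to
    be rewritten: each original clause carries a label, clauses with equal
    labels stand for their union, and label 0 means dropped. Eliminating one
    variable is one scan of the input and one pass over the labels, hence linear
    time, and Satisfier wins iff all labels end up 0. The machine program is
    obtained by compiling a small structured language with a cost semantics. *)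

(** * Variable elimination on labelled clauses *)

(** The payoff is an arbitrary predicate on complete assignments, so that the innermost quantifier
    can be absorbed into it. *)
Fixpoint game (f : seq bool -> bool) (qs prefix : seq bool) : bool :=
  if qs is q :: qs' then
    if q then game f qs' (rcons prefix true) || game f qs' (rcons prefix false)
    else game f qs' (rcons prefix true) && game f qs' (rcons prefix false)
  else f prefix.

Definition quantify (q : bool) (f : seq bool -> bool) (s : seq bool) : bool :=
  if q then f (rcons s true) || f (rcons s false)
  else f (rcons s true) && f (rcons s false).

Lemma sat_wins_from_game qs prefix phi :
  sat_wins_from qs prefix phi =
  game (fun s => eval_cnf (nth false s) phi) qs prefix.
Proof. by elim: qs prefix => [|q qs IH] prefix //=; rewrite !IH. Qed.

Lemma game_rcons f qs q prefix :
  game f (rcons qs q) prefix = game (quantify q f) qs prefix.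
Proof. by elim: qs prefix => [|q' qs IH] prefix //=; rewrite !IH. Qed.

Lemma eq_game f g qs prefix :
  (forall s, size s = size prefix + size qs -> f s = g s) ->
  game f qs prefix = game g qs prefix.
Proof.
elim: qs prefix => [|q qs IH] prefix fg /=; first by apply: fg; rewrite addn0.
have fg' b : game f qs (rcons prefix b) = game g qs (rcons prefix b).
  by apply: IH => s; rewrite size_rcons addSnnS; apply: fg.
by rewrite !fg'.
Qed.

Definition occurrences (x : literal) (cls : seq (clause * nat)) : seq nat :=
  flatten [seq nseq (count_mem x D.1) D.2 | D <- cls].

Definition first_live (s : seq nat) : nat := head 0 [seq a <- s | a != 0].

(** Nonzero only for a genuine resolution: the variable is existential, each polarity has one live
    label, and the two differ. The merged class then takes the label [n1]; otherwise the affected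
    classes are dropped. *)
Definition target (q : bool) (p1 p2 n1 n2 : nat) : nat :=
  if [&& q, p1 == p2, n1 == n2, p1 != 0 & p1 != n1] then n1 else 0.

(** An existential variable affects every class containing it, a universal one only the tautological
    classes. *)
Definition hit (q : bool) (p1 p2 n1 n2 a : nat) : bool :=
  if q then (a \in [:: p1; p2]) || (a \in [:: n1; n2])
  else (a \in [:: p1; p2]) && (a \in [:: n1; n2]).

Definition relabel (q : bool) (p1 p2 n1 n2 : nat) (labels : seq nat) : seq nat :=
  [seq if hit q p1 p2 n1 n2 a then target q p1 p2 n1 n2 else a | a <- labels].

Definition eliminate (phi : cnf) (v : nat) (q : bool) (labels : seq nat) :=
  let ps := occurrences (v, true) (zip phi labels) in
  let ns := occurrences (v, false) (zip phi labels) in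
  relabel q (first_live ps) (last 0 ps) (first_live ns) (last 0 ns) labels.

Fixpoint eliminate_below (phi : cnf) (qs : seq bool) (k : nat) (labels : seq nat) :=
  if k is k'.+1 then
    eliminate_below phi qs k' (eliminate phi k' (nth false qs k') labels)
  else labels.

(** The test [l.1 < size s] ignores literals of variables already eliminated: this is how a literal
    is erased without rewriting a clause. *)
Definition sat_below (s : seq bool) (cls : seq (clause * nat)) (a : nat) : bool :=
  has (fun D => (D.2 == a) &&
    has (fun l => (l.1 < size s) && eval_lit (nth false s) l) D.1) cls.

Definition eval_labelled (phi : cnf) (labels : seq nat) (s : seq bool) : bool :=
  all (fun a => (a == 0) || sat_below s (zip phi labels) a) labels.

Definition occurs_in (cls : seq (clause * nat)) (x : literal) (a : nat) : bool :=
  has (fun D => (D.2 == a) && (x \in D.1)) cls.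

Lemma mem_occurrences cls x a : (a \in occurrences x cls) = occurs_in cls x a.
Proof.
apply/flatten_mapP/hasP => -[D Dcls].
  by rewrite mem_nseq -has_count has_pred1 => /andP[xD /eqP ->]; exists D; rewrite ?eqxx.
move=> /andP[/eqP <- xD]; exists D => //.
by rewrite mem_nseq -has_count has_pred1 xD eqxx.
Qed.

Lemma sat_below_rcons s b cls a :
  sat_below (rcons s b) cls a = sat_below s cls a || occurs_in cls (size s, b) a.
Proof.
rewrite /sat_below /occurs_in -has_predU; apply: eq_has => D /=.
rewrite -andb_orr; congr (_ && _).
rewrite -has_pred1 -has_predU; apply: eq_has => -[v c] /=.
rewrite size_rcons ltnS leq_eqVlt /eval_lit nth_rcons /=.
case: ltngtP => [lt_v|gt_v|->] /=.
- by rewrite xpair_eqE (ltn_eqF lt_v) orbF.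
- by rewrite xpair_eqE (gtn_eqF gt_v).
- by rewrite xpair_eqE eqxx; case: c; case: b.
Qed.

(** The labels [a] and [b] are chosen before the polarity [c]: the same pair, in the same order,
    serves both polarities, so that their occurrence lists can be compared. *)
Lemma occurrences_two_clauses (cls : seq (clause * nat)) (v : nat) :
  count (fun D : clause * nat => has (fun l : literal => l.1 == v) D.1) cls <= 2 ->
  exists (a b : nat), forall c,
    exists i j, occurrences (v, c) cls = nseq i a ++ nseq j b.
Proof.
set f := fun D : clause * nat => has _ D.1.
have nilE D c : f D = false -> count_mem (v, c) D.1 = 0.
  move=> fD; apply/eqP; rewrite -leqn0 leqNgt -has_count has_pred1.
  by apply/negP => vcD; move/hasP: fD; case; exists (v, c) => /=.
have filtE c : occurrences (v, c) cls = occurrences (v, c) (filter f cls).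
  rewrite /occurrences; elim: cls => //= D cls ->.
  by case fD: (f D) => //=; rewrite nilE.
rewrite -size_filter.
have: forall c, occurrences (v, c) cls = occurrences (v, c) (filter f cls) by [].
case: (filter f cls) => [|D [|E []]] //= occE _.
- by exists 0, 0 => c; exists 0, 0; rewrite occE.
- by exists D.2, 0 => c; exists (count_mem (v, c) D.1), 0; rewrite occE /occurrences /= !cats0.
- exists D.2, E.2 => c; exists (count_mem (v, c) D.1), (count_mem (v, c) E.1).
  by rewrite occE /occurrences /= cats0.
Qed.

(* With at most two clauses containing the variable, the first live and the
   last occurrence of each polarity already determine all labels involved. *)
Lemma first_last_two i j (a b : nat) s :
  s = nseq i a ++ nseq j b ->
  [/\ forall x, x != 0 -> (x \in s) = (x \in [:: first_live s; last 0 s]),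
      (first_live s \in [:: 0; a; b]) &
      if first_live s == 0 then last 0 s == 0 else last 0 s \in [:: a; b]].
Proof.
move=> ->; rewrite /first_live last_cat filter_cat !filter_nseq.
have lastn k (c d : nat) : last c (nseq k d) = if k is 0 then c else d.
  by case: k => //= k; elim: k.
rewrite !lastn.
split.
- move=> x /negPf x0; rewrite mem_cat !mem_nseq !inE.
  by case: i j => [|i] [|j]; case: (eqVneq a 0) => [->|an0];
    case: (eqVneq b 0) => [->|bn0] //=; rewrite ?muln0 ?mul1n ?x0 ?orbF ?orbb //=.
- by case: i j => [|i] [|j]; case: (eqVneq a 0) => [->|an0];
    case: (eqVneq b 0) => [->|bn0] //=; rewrite ?mul1n !inE ?eqxx ?orbT.
- by case: i j => [|i] [|j]; case: (eqVneq a 0) => [->|/negPf an0];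
    case: (eqVneq b 0) => [->|/negPf bn0] //=;
    rewrite ?mul1n ?an0 ?bn0 /= ?an0 ?bn0 ?inE ?eqxx ?orbT.
Qed.

Lemma size_eliminate phi v q labels : size (eliminate phi v q labels) = size labels.
Proof. by rewrite size_map. Qed.

Lemma zip_map_r (S T U : Type) (f : T -> U) (s : seq S) (t : seq T) :
  zip s (map f t) = [seq (x.1, f x.2) | x <- zip s t].
Proof. by elim: s t => [|x s IH] [|y t] //=; rewrite IH. Qed.

Lemma sat_below_map s (phi : cnf) labels f a :
  sat_below s (zip phi (map f labels)) a =
  has (fun D : clause * nat => (f D.2 == a) &&
    has (fun l : literal => (l.1 < size s) && eval_lit (nth false s) l) D.1) (zip phi labels).
Proof. by rewrite zip_map_r /sat_below has_map; apply: eq_has => D. Qed.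

Lemma occurs_in_label phi labels x a :
  occurs_in (zip phi labels) x a -> a \in labels.
Proof.
case/hasP=> -[C b] /= Dz /andP[/eqP <- _].
have : b \in unzip2 (zip phi labels) by apply/mapP; exists (C, b).
elim: phi labels {Dz} => [|D phi IH] [|c l] //=.
by rewrite !inE => /orP[->//|/IH ->]; rewrite orbT.
Qed.

Lemma count_zip phi labels v :
  count (fun D : clause * nat => has (fun l : literal => l.1 == v) D.1) (zip phi labels)
    <= degree phi v.
Proof.
rewrite /degree; elim: phi labels => [|C phi IH] [|a l] //=.
by rewrite leq_add2l.
Qed.

(** Both sets of live labels lie in the pair [a], [b], and two subsets of a pair are incomparable
    only if they are distinct singletons, the case where [target] is nonzero. Comparability lets one
    value of the variable satisfy every class containing it. *)
Lemma target0_comparable (p1 p2 n1 n2 a b : nat) :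
  p1 \in [:: 0; a; b] -> (if p1 == 0 then p2 == 0 else p2 \in [:: a; b]) ->
  n1 \in [:: 0; a; b] -> (if n1 == 0 then n2 == 0 else n2 \in [:: a; b]) ->
  target true p1 p2 n1 n2 = 0 ->
  (forall x, x != 0 -> x \in [:: p1; p2] -> x \in [:: n1; n2]) \/
  (forall x, x != 0 -> x \in [:: n1; n2] -> x \in [:: p1; p2]).
Proof.
rewrite /target !inE.
have [/allP|] := boolP (all (fun x => (x != 0) ==> (x \in [:: n1; n2])) [:: p1; p2]).
  move=> sub *; left=> x x0 xp; have := sub _ xp; by rewrite x0.
have [/allP|] := boolP (all (fun x => (x != 0) ==> (x \in [:: p1; p2])) [:: n1; n2]).
  move=> sub *; right=> x x0 xp; have := sub _ xp; by rewrite x0.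
rewrite /= !inE; do 3!case: ifP; lia.
Qed.

(** * Soundness of eliminating one variable *)

Section Elimination.

Variables (phi : cnf) (v : nat) (labels : seq nat).
Hypothesis deg : degree phi v <= 2.

Let cls := zip phi labels.
Let ps := occurrences (v, true) cls.
Let ns := occurrences (v, false) cls.
Let p1 := first_live ps.
Let p2 := last 0 ps.
Let n1 := first_live ns.
Let n2 := last 0 ns.

Lemma two_labels : exists a b, forall c,
  let s := occurrences (v, c) cls in
  [/\ forall x, x != 0 -> occurs_in cls (v, c) x = (x \in [:: first_live s; last 0 s]),
      (first_live s \in [:: 0; a; b]) &
      if first_live s == 0 then last 0 s == 0 else last 0 s \in [:: a; b]].
Proof.
have [a [b H]] := occurrences_two_clauses (leq_trans (count_zip _ labels _) deg).
exists a, b => c; have [i [j E]] := H c.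
by have [H1 H2 H3] := first_last_two E; split=> // x x0; rewrite -mem_occurrences H1.
Qed.

(** Whole classes are sent to 0, so the surviving classes lose no clause and the dropped ones count
    as true. *)
Lemma eval_kill s (f : pred nat) :
  eval_labelled phi [seq if f a then 0 else a | a <- labels] s =
  all (fun a => (a == 0) || f a || sat_below s cls a) labels.
Proof.
rewrite /eval_labelled all_map; apply: eq_all => a /=.
case fa: (f a) => /=; first by rewrite orbT.
rewrite orbF; case: eqVneq => //= a0.
rewrite sat_below_map; apply: eq_has => D /=; congr (_ && _).
case fD: (f D.2) => //; case: eqVneq => [E|_]; first by rewrite -E eqxx in a0.
by case: eqVneq => // E; rewrite -E fD in fa.
Qed.

(** A universal variable is handled by distributivity; an existential one by choosing the dominant
    polarity when [target] is 0, and by resolution otherwise. *)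
Lemma eval_eliminate q s : size s = v ->
  eval_labelled phi (eliminate phi v q labels) s = quantify q (eval_labelled phi labels) s.
Proof.
move=> sv; have [a [b H]] := two_labels.
have [/= posE p1ab p2ab] := H true; have [/= negE n1ab n2ab] := H false.
have evE c : eval_labelled phi labels (rcons s c) =
    all (fun a => (a == 0) || sat_below s cls a || occurs_in cls (v, c) a) labels.
  by apply: eq_all => x; rewrite sat_below_rcons sv orbA.
rewrite /quantify !evE /eliminate /relabel -/ps -/ns -/p1 -/p2 -/n1 -/n2.
(* A class survives both values of a universal variable iff its other literals satisfy it or it
   contains both polarities. *)
case: q; last first.
  rewrite eval_kill -all_predI; apply: eq_all => x /=.
  case: (eqVneq x 0) => //= x0; rewrite posE // negE // /hit.
  by rewrite orbC orb_andr.
have [t0|] := eqVneq (target true p1 p2 n1 n2) 0.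
  rewrite t0 eval_kill.
  apply/idP/idP.
    move=> /allP kill.
    (* The variable receives the polarity whose set of classes is the larger one. *)
    case: (target0_comparable p1ab p2ab n1ab n2ab t0) => sub; apply/orP; [right|left].
      apply/allP=> x xl; have := kill _ xl.
      case: (eqVneq x 0) => //= x0; rewrite negE // /hit -/ns -/n1 -/n2.
      by case/orP=> [/orP[/(sub _ x0)->|->]|->]; rewrite ?orbT.
    apply/allP=> x xl; have := kill _ xl.
    case: (eqVneq x 0) => //= x0; rewrite posE // /hit -/ps -/p1 -/p2.
    by case/orP=> [/orP[->|/(sub _ x0)->]|->]; rewrite ?orbT.
  case/orP=> /allP sat; apply/allP=> x xl; have := sat _ xl.
    case: (eqVneq x 0) => //= x0; rewrite posE // /hit -/ps -/p1 -/p2.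
    by case/orP=> ->; rewrite ?orbT.
  case: (eqVneq x 0) => //= x0; rewrite negE // /hit -/ns -/n1 -/n2.
  by case/orP=> ->; rewrite ?orbT.
rewrite /target; case: ifP => // /and5P[_ /eqP p12 /eqP n12 p1n0 p1n1] n1n0.
rewrite /hit -p12 -n12 /=.
have posE' x : x != 0 -> occurs_in cls (v, true) x = (x == p1).
  by move=> x0; rewrite posE // -/ps -/p1 -/p2 -p12 !inE orbb.
have negE' x : x != 0 -> occurs_in cls (v, false) x = (x == n1).
  by move=> x0; rewrite negE // -/ns -/n1 -/n2 -n12 !inE orbb.
have p1l : p1 \in labels by apply: (@occurs_in_label phi _ (v, true)); rewrite posE'.
have n1l : n1 \in labels by apply: (@occurs_in_label phi _ (v, false)); rewrite negE'.
(* [g] sends [p1] to [n1], merging the two parent classes into their resolvent. *)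
set g := fun x => if _ then n1 else x.
have gn : g n1 = n1 by rewrite /g !inE eqxx !orbT.
have gp : g p1 = n1 by rewrite /g !inE eqxx.
have gE x : x != p1 -> x != n1 -> g x = x.
  by move=> /negPf xp /negPf xn; rewrite /g !inE xp xn.
have satE x : x != 0 -> x != p1 -> sat_below s (zip phi (map g labels)) x =
    sat_below s cls x || (x == n1) && sat_below s cls p1.
  move=> x0 xp; rewrite sat_below_map /sat_below.
  case: (eqVneq x n1) => [->|xn1] /=; last first.
    rewrite orbF; apply: eq_has => D /=; congr (_ && _); rewrite /g !inE !orbb.
    case: (eqVneq D.2 p1) => [->|_] /=; first by rewrite eq_sym (negPf xn1) eq_sym (negPf xp).
    by case: (eqVneq D.2 n1) => [->|_].
  rewrite -has_predU; apply: eq_has => D /=; rewrite -andb_orl; congr (_ && _).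
  rewrite /g !inE !orbb; case: (eqVneq D.2 p1) => [->|_] /=; first by rewrite eqxx orbT.
  by case: (eqVneq D.2 n1) => [_|/negPf Dn]; rewrite ?eqxx ?Dn.
rewrite /eval_labelled all_map.
apply/allP/orP => [sat|].
  (* The resolvent holds through one of its parents; the variable is set so as to satisfy the other
     parent. *)
  have := sat _ n1l; rewrite /= gn (negPf n1n0) /=.
  rewrite satE // 1?eq_sym // eqxx /= => /orP[sn|sp]; [left|right].
    apply/allP=> x xl; case: (eqVneq x 0) => //= x0; rewrite posE' //.
    case: (eqVneq x p1) => [|xp] //=; first by rewrite orbT.
    rewrite orbF; have := sat _ xl.
    case: (eqVneq x n1) => [->//|xn]; rewrite /= gE // (negPf x0) /= satE //.
    by rewrite (negPf xn) orbF.
  apply/allP=> x xl; case: (eqVneq x 0) => //= x0; rewrite negE' //.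
  case: (eqVneq x n1) => [|xn] //=; first by rewrite orbT.
  rewrite orbF; have := sat _ xl.
  case: (eqVneq x p1) => [->//|xp]; rewrite /= gE // (negPf x0) /= satE //.
  by rewrite (negPf xn) orbF.
move=> alt x xl; rewrite /=.
(* Either value of the variable leaves one parent unaided, and that parent must hold by its
   remaining literals. *)
have satn : sat_below s cls n1 || sat_below s cls p1.
  case: alt => /allP alt.
    by have := alt _ n1l; rewrite posE' // (negPf n1n0) eq_sym (negPf p1n1) /= orbF => ->.
  by have := alt _ p1l; rewrite negE' // (negPf p1n0) (negPf p1n1) /= orbF => ->; rewrite orbT.
have gnE : g x = n1 -> (g x == 0) || sat_below s (zip phi (map g labels)) (g x).
  by move=> ->; rewrite satE // 1?eq_sym // eqxx satn orbT.
case: (eqVneq x p1) => [xp|xp]; first by apply: gnE; rewrite xp.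
case: (eqVneq x n1) => [xn|xn]; first by apply: gnE; rewrite xn.
rewrite gE //; case: (eqVneq x 0) => //= x0; rewrite satE // (negPf xn) orbF.
by case: alt => /allP/(_ _ xl); rewrite (negPf x0) /= ?posE' ?negE' // ?(negPf xp) ?(negPf xn) orbF.
Qed.

End Elimination.

(** Distinct labels make every class a single clause; they start at 1 because 0 means dropped. *)
Lemma eval_labelled_iota (phi : cnf) (s : seq bool) :
  (forall C, C \in phi -> forall l, l \in C -> l.1 < size s) ->
  eval_labelled phi (iota 1 (size phi)) s = eval_cnf (nth false s) phi.
Proof.
move=> wf.
have sizeE : size phi = size (iota 1 (size phi)) by rewrite size_iota.
have nthE j : j < size phi ->
    nth ([::], 0) (zip phi (iota 1 (size phi))) j = (nth [::] phi j, j.+1).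
  by move=> lt_j; rewrite nth_zip // nth_iota // add1n.
apply/allP/allP => H.
  move=> C /(nthP [::])[j lt_j <-].
  have /H : j.+1 \in iota 1 (size phi) by rewrite mem_iota add1n !ltnS.
  case/hasP=> -[D d] /(nthP ([::], 0))[i].
  rewrite size_zip -sizeE minnn => lt_i; rewrite nthE // => -[<- <-] /=.
  rewrite eqSS => /andP[/eqP ij] /hasP[l lC /andP[_ ev]].
  by apply/hasP; exists l; rewrite // -ij.
move=> [|j]; rewrite mem_iota add1n // ltnS => /= lt_j.
apply/hasP; exists (nth [::] phi j, j.+1).
  by rewrite -nthE // mem_nth // size_zip -sizeE minnn.
rewrite /= eqxx /=.
have Cphi := mem_nth [::] lt_j; have /hasP[l lC ev] := H _ Cphi.
by apply/hasP; exists l; rewrite // ev (wf _ Cphi).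
Qed.

(** [game_rcons] moves the last quantifier of the prefix into the payoff, where [eval_eliminate]
    turns it into a relabelling. *)
Lemma game_eliminate_below phi qs labels k :
  (forall v, degree phi v <= 2) -> k <= size qs ->
  game (eval_labelled phi labels) (take k qs) [::] =
  all (pred1 0) (eliminate_below phi qs k labels).
Proof.
move=> deg; elim: k labels => [|k IH] labels lt_k /=.
  (* With no variable assigned no class is satisfied, so only the label 0 evaluates to true. *)
  rewrite take0 /eval_labelled /=; apply: eq_all => a.
  rewrite /= (_ : sat_below _ _ _ = false) ?orbF //.
  by apply/hasP => -[D _ /andP[_ /hasP[l]]].
rewrite (take_nth false) // game_rcons -IH 1?ltnW //.
apply: eq_game => s; rewrite size_takel 1?ltnW // => sk.
by rewrite eval_eliminate.
Qed.

Theorem satisfier_winsE qs phi :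
  wf_qbf qs phi -> (forall v, degree phi v <= 2) ->
  satisfier_wins qs phi =
  all (pred1 0) (eliminate_below phi qs (size qs) (iota 1 (size phi))).
Proof.
move=> wf deg; rewrite -game_eliminate_below // take_size /satisfier_wins.
rewrite sat_wins_from_game; apply: eq_game => s /= sz.
by rewrite eval_labelled_iota // sz.
Qed.

(** * A structured language over the random-access machine *)

Local Notation memory := (nat -> nat).
Local Notation nscratch := 32.
Local Notation rzero := 31.

Inductive cmd : Type :=
| Basic of instr
| Seq of cmd & cmd
| If of nat & cmd & cmd
| While of nat & cmd
| Skip.

Fixpoint csize (c : cmd) : nat :=
  match c with
  | Basic _ => 1
  | Seq c1 c2 => csize c1 + csize c2
  | If _ c1 c2 => csize c1 + csize c2 + 3
  | While _ c => csize c + 3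
  | Skip => 0
  end.

(** Clearing the reserved register [rzero] and testing it with [IJz] acts as an unconditional jump.
    Jump targets are absolute, hence the code address [o]. *)
Fixpoint compile (o : nat) (c : cmd) : program :=
  match c with
  | Basic i => [:: i]
  | Seq c1 c2 => compile o c1 ++ compile (o + csize c1) c2
  | If r c1 c2 =>
      let o2 := o + csize c1 + 3 in
      IJz r o2 :: compile o.+1 c1 ++
        [:: IConst rzero 0; IJz rzero (o2 + csize c2)] ++ compile o2 c2
  | While r c =>
      IJz r (o + csize c + 3) :: compile o.+1 c ++ [:: IConst rzero 0; IJz rzero o]
  | Skip => [::]
  end.

Lemma size_compile o c : size (compile o c) = csize c.
Proof.
elim: c o => //= [c1 IH1 c2 IH2|r c1 IH1 c2 IH2|r c IH] o;
  rewrite ?size_cat /= ?size_cat ?IH1 ?IH2 ?IH //=; lia.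
Qed.

(* The state is split into the registers below [nscratch] and the remaining
   memory, which is only ever accessed through [ILoad] and [IStore]. *)
Definition join (e h : memory) : memory := fun i => if i < nscratch then e i else h i.

Definition scratch_instr (i : instr) : bool :=
  match i with
  | IConst r _ => r < nscratch
  | IAdd r a b | ISub r a b => [&& r < nscratch, a < nscratch & b < nscratch]
  | ILoad r a | IStore a r => (r < nscratch) && (a < nscratch)
  | IJz _ _ | IHalt => false
  end.

Fixpoint scratch_cmd (c : cmd) : bool :=
  match c with
  | Basic i => scratch_instr i
  | Seq c1 c2 => scratch_cmd c1 && scratch_cmd c2
  | If r c1 c2 => [&& r < nscratch, scratch_cmd c1 & scratch_cmd c2]
  | While r c => (r < nscratch) && scratch_cmd c
  | Skip => true
  end.

(** Indirect accesses must stay above the scratch registers, which keeps the two halves of the state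
    independent. *)
Definition address_ok (i : instr) (e : memory) : bool :=
  match i with
  | ILoad _ a | IStore a _ => nscratch <= e a
  | _ => true
  end.

Definition step_scratch (i : instr) (e h : memory) : memory :=
  match i with
  | IConst r k => upd e r k
  | IAdd r a b => upd e r (e a + e b)
  | ISub r a b => upd e r (e a - e b)
  | ILoad r a => upd e r (h (e a))
  | _ => e
  end.

Definition step_heap (i : instr) (e h : memory) : memory :=
  if i is IStore a r then upd h (e a) (e r) else h.

(** The last index counts machine steps exactly. The first branch of [If] and each loop iteration
    cost three more, the test and the two-instruction jump, and leave [rzero] cleared. *)
Inductive exec : cmd -> memory -> memory -> memory -> memory -> nat -> Prop :=
| exec_Basic i e h : address_ok i e ->
    exec (Basic i) e h (step_scratch i e h) (step_heap i e h) 1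
| exec_Seq c1 c2 e h e1 h1 t1 e2 h2 t2 :
    exec c1 e h e1 h1 t1 -> exec c2 e1 h1 e2 h2 t2 ->
    exec (Seq c1 c2) e h e2 h2 (t1 + t2)
| exec_IfT r c1 c2 (e h : memory) e1 h1 t : e r != 0 -> exec c1 e h e1 h1 t ->
    exec (If r c1 c2) e h (upd e1 rzero 0) h1 t.+3
| exec_IfF r c1 c2 e h e1 h1 t : e r = 0 -> exec c2 e h e1 h1 t ->
    exec (If r c1 c2) e h e1 h1 t.+1
| exec_While0 r c e h : e r = 0 -> exec (While r c) e h e h 1
| exec_WhileS r c (e h : memory) e1 h1 t1 e2 h2 t2 : e r != 0 ->
    exec c e h e1 h1 t1 -> exec (While r c) (upd e1 rzero 0) h1 e2 h2 t2 ->
    exec (While r c) e h e2 h2 (t1 + t2).+3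
| exec_Skip e h : exec Skip e h e h 0.

Local Arguments run : simpl never.

Lemma run_add p s t x : run p (s + t) x = run p t (run p s x).
Proof. by rewrite /run addnC iterD. Qed.

Lemma runS p t x : run p t.+1 x = run p t (step p x).
Proof. exact: iterSr. Qed.

Lemma step_basic i p o m e h :
  nth IHalt p o = i -> scratch_instr i -> address_ok i e -> m =1 join e h ->
  exists2 m', step p (Config o m) = Config o.+1 m' &
    m' =1 join (step_scratch i e h) (step_heap i e h).
Proof.
move=> pE + + mE; rewrite /step /cur /= pE.
case: i {pE} => [r k|r a b|r a b|r a|a r|r a|] //=.
- move=> r_lt _; eexists; first by [].
  by move=> j; rewrite /join /upd mE /join; case: (eqVneq j r) => [->|_]; rewrite ?r_lt.
- move=> /and3P[r_lt a_lt b_lt] _; eexists; first by [].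
  by move=> j; rewrite /join /upd !mE /join a_lt b_lt; case: (eqVneq j r) => [->|_]; rewrite ?r_lt.
- move=> /and3P[r_lt a_lt b_lt] _; eexists; first by [].
  by move=> j; rewrite /join /upd !mE /join a_lt b_lt; case: (eqVneq j r) => [->|_]; rewrite ?r_lt.
- move=> /andP[r_lt a_lt] ea; eexists; first by [].
  move=> j; rewrite /join /upd !mE /join a_lt ltnNge ea /=.
  by case: (eqVneq j r) => [->|_]; rewrite ?r_lt.
- move=> /andP[r_lt a_lt] ea; eexists; first by [].
  move=> j; rewrite /join /upd !mE /join a_lt r_lt.
  by case: (eqVneq j (e a)) => [->|_]; rewrite // ltnNge ea.
Qed.

Lemma step_jz r l p o m :
  nth IHalt p o = IJz r l ->
  step p (Config o m) = Config (if m r == 0 then l else o.+1) m.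
Proof. by move=> pE; rewrite /step /cur /= pE. Qed.

Definition code_at (p : program) (o : nat) (s : program) : Prop :=
  forall j, j < size s -> nth IHalt p (o + j) = nth IHalt s j.

Lemma code_at_cat p o s1 s2 :
  code_at p o (s1 ++ s2) -> code_at p o s1 /\ code_at p (o + size s1) s2.
Proof.
move=> ps; split=> j lt_j.
  by rewrite ps ?size_cat ?nth_cat ?lt_j // ltn_addr.
by rewrite -addnA ps ?size_cat ?ltn_add2l // nth_cat ltnNge leq_addr /= addKn.
Qed.

Lemma code_at_cons p o i s :
  code_at p o (i :: s) -> nth IHalt p o = i /\ code_at p o.+1 s.
Proof.
move=> ps; split; first by rewrite -[o]addn0 ps.
by move=> j lt_j; rewrite addSnnS ps.
Qed.

(** Induction on the execution rather than on the command provides the hypothesis for the remaining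
    iterations of a loop. *)
Lemma compile_correct c e h e' h' t :
  exec c e h e' h' t -> scratch_cmd c ->
  forall p o m, code_at p o (compile o c) -> m =1 join e h ->
  exists2 m', run p t (Config o m) = Config (o + csize c) m' & m' =1 join e' h'.
Proof.
(* The two-instruction jump that ends a first branch or a loop body. *)
have goto p o l m (e1 h1 : memory) : nth IHalt p o = IConst rzero 0 ->
    nth IHalt p o.+1 = IJz rzero l -> m =1 join e1 h1 ->
    exists2 m', run p 2 (Config o m) = Config l m' & m' =1 join (upd e1 rzero 0) h1.
  move=> pE pj mE.
  have [m' sE m'E] := step_basic (e := e1) (h := h1) pE isT isT mE.
  exists m'; last by [].
  by rewrite /run /= sE (step_jz _ pj) m'E.
elim=> {c e h e' h' t}.
- move=> i e h ok wf p o m /code_at_cons[pE _] mE.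
  have [m' sE m'E] := step_basic pE wf ok mE.
  by exists m'; rewrite // addn1 /run /= sE.
- move=> c1 c2 e h e1 h1 t1 e2 h2 t2 _ IH1 _ IH2 /= /andP[wf1 wf2] p o m.
  case/code_at_cat; rewrite size_compile => p1 p2 mE.
  have [m1 r1 m1E] := IH1 wf1 _ _ _ p1 mE.
  have [m2 r2 m2E] := IH2 wf2 _ _ _ p2 m1E.
  by exists m2; rewrite // run_add r1 r2 addnA.
- move=> r c1 c2 e h e1 h1 t er _ IH /= /and3P[r_lt wf1 wf2] p o m.
  case/code_at_cons=> p0 /code_at_cat[]; rewrite size_compile => p1.
  case/code_at_cons=> p2 /code_at_cons[p3 _] mE.
  have [m1 r1 m1E] := IH wf1 _ _ _ p1 mE.
  have [m2 r2 m2E] := goto _ _ _ _ _ _ p2 p3 m1E.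
  exists m2 => //; rewrite (_ : t.+3 = (t + 2).+1); last by lia.
  rewrite runS run_add (step_jz _ p0).
  rewrite mE /join r_lt (negPf er) r1 r2; congr Config; lia.
- move=> r c1 c2 e h e1 h1 t er _ IH /= /and3P[r_lt wf1 wf2] p o m.
  case/code_at_cons=> p0 /code_at_cat[_]; rewrite size_compile.
  case/code_at_cons=> _ /code_at_cons[_ p1] mE.
  rewrite (_ : _.+2 = o + csize c1 + 3) in p1; last by lia.
  have [m1 r1 m1E] := IH wf2 _ _ _ p1 mE.
  exists m1 => //; rewrite runS (step_jz _ p0).
  rewrite mE /join r_lt er eqxx r1; congr Config; lia.
- move=> r c e h er /= /andP[r_lt _] p o m /code_at_cons[p0 _] mE.
  exists m => //; rewrite /run /= (step_jz _ p0) mE /join r_lt er eqxx.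
  congr Config; lia.
- move=> r c e h e1 h1 t1 e2 h2 t2 er _ IH1 _ IH2 wf p o m pw mE.
  have /= /andP[r_lt wf1] := wf.
  have /= /code_at_cons[p0 /code_at_cat[]] := pw; rewrite size_compile => p1.
  case/code_at_cons=> p2 /code_at_cons[p3 _].
  have [m1 r1 m1E] := IH1 wf1 _ _ _ p1 mE.
  have [m2 r2 m2E] := goto _ _ _ _ _ _ p2 p3 m1E.
  have [m3 r3 m3E] := IH2 wf _ _ _ pw m2E.
  exists m3 => //; rewrite (_ : _.+3 = (t1 + (2 + t2)).+1); last by lia.
  by rewrite runS !run_add (step_jz _ p0) mE /join r_lt (negPf er) r1 r2 r3.
- by move=> e h _ p o m _ mE; exists m; rewrite //= addn0.
Qed.

(** * Weakest preconditions for total correctness with running time *)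

Definition wp (c : cmd) (Q : memory -> memory -> nat -> Prop) (e h : memory) : Prop :=
  exists e' h' t, exec c e h e' h' t /\ Q e' h' t.

Lemma wp_conseq c (Q Q' : memory -> memory -> nat -> Prop) e h :
  wp c Q e h -> (forall e' h' t, Q e' h' t -> Q' e' h' t) -> wp c Q' e h.
Proof. by move=> [e' [h' [t [ex q]]]] QQ; exists e', h', t; split=> //; apply: QQ. Qed.

Lemma wp_Basic i (Q : memory -> memory -> nat -> Prop) e h : address_ok i e ->
  Q (step_scratch i e h) (step_heap i e h) 1 -> wp (Basic i) Q e h.
Proof. by move=> ok q; do 3!eexists; split; [apply: exec_Basic | exact: q]. Qed.

Lemma wp_Seq c1 c2 (Q : memory -> memory -> nat -> Prop) e h :
  wp c1 (fun e1 h1 t1 => wp c2 (fun e2 h2 t2 => Q e2 h2 (t1 + t2)) e1 h1) e h ->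
  wp (Seq c1 c2) Q e h.
Proof.
move=> [e1 [h1 [t1 [x1 [e2 [h2 [t2 [x2 q]]]]]]]].
by do 3!eexists; split; [apply: exec_Seq x1 x2 | exact: q].
Qed.

Lemma wp_If r c1 c2 (Q : memory -> memory -> nat -> Prop) e h :
  (e r != 0 -> wp c1 (fun e' h' t => Q (upd e' rzero 0) h' t.+3) e h) ->
  (e r == 0 -> wp c2 (fun e' h' t => Q e' h' t.+1) e h) ->
  wp (If r c1 c2) Q e h.
Proof.
move=> q1 q2; case: (eqVneq (e r) 0) => er.
  have [e' [h' [t [x q]]]] := q2 (introT eqP er).
  by do 3!eexists; split; [apply: exec_IfF er x | exact: q].
have [e' [h' [t [x q]]]] := q1 er.
by do 3!eexists; split; [apply: exec_IfT er x | exact: q].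
Qed.

Lemma wp_While0 r c (Q : memory -> memory -> nat -> Prop) e h :
  e r = 0 -> Q e h 1 -> wp (While r c) Q e h.
Proof. by move=> er q; do 3!eexists; split; [apply: exec_While0 er | exact: q]. Qed.

Lemma wp_WhileS r c (Q : memory -> memory -> nat -> Prop) e h : e r != 0 ->
  wp c (fun e1 h1 t1 =>
    wp (While r c) (fun e2 h2 t2 => Q e2 h2 (t1 + t2).+3) (upd e1 rzero 0) h1) e h ->
  wp (While r c) Q e h.
Proof.
move=> er [e1 [h1 [t1 [x1 [e2 [h2 [t2 [x2 q]]]]]]]].
by do 3!eexists; split; [apply: exec_WhileS er x1 x2 | exact: q].
Qed.

Lemma wp_Skip (Q : memory -> memory -> nat -> Prop) e h : Q e h 0 -> wp Skip Q e h.
Proof. by move=> q; do 3!eexists; split; [apply: exec_Skip | exact: q]. Qed.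

Local Notation "c1 ;; c2" := (Seq c1 c2) (at level 60, right associativity).
Local Arguments upd m r v i /.

Fixpoint block (s : seq instr) : cmd := if s is i :: s' then Basic i ;; block s' else Skip.

Lemma wp_block_cons i s (Q : memory -> memory -> nat -> Prop) e h : address_ok i e ->
  wp (block s) (fun e' h' t => Q e' h' t.+1) (step_scratch i e h) (step_heap i e h) ->
  wp (block (i :: s)) Q e h.
Proof. by move=> ok q; apply: wp_Seq; apply: wp_Basic => //; apply: wp_conseq q _. Qed.

Local Arguments block : simpl never.

Ltac steps := do ?[apply: wp_block_cons; [done | rewrite /=]].

Definition frame (S : seq nat) (e e' : memory) := forall i, i \notin S -> e' i = e i.

Ltac framed :=
  try match goal with |- frame _ _ ?e => unfold e end;
  let i := fresh "i" in move=> i; rewrite /= !inE;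
  repeat match goal with |- context [i == ?r] => case: (i == r) => //= end.

Lemma frame_weaken S1 S e e1 : frame S1 e e1 -> all (fun i => i \in S) S1 -> frame S e e1.
Proof. by move=> fr /allP sub i iS; apply: fr; apply: contra iS; apply: sub. Qed.

Lemma frame_trans S1 S2 S e e1 e2 :
  frame S1 e e1 -> frame S2 e1 e2 -> all (fun i => i \in S) (S1 ++ S2) -> frame S e e2.
Proof.
move=> fr1 fr2; rewrite all_cat => /andP[/allP sub1 /allP sub2] i iS.
by rewrite fr2 ?fr1 //; apply: contra iS; [apply: sub1 | apply: sub2].
Qed.

(** * The program *)

Local Notation rone := 1.
Local Notation rbase := 2. (* address of the copied input *)
Local Notation rptr := 3. (* reads the encoded clauses *)
Local Notation rlab := 4. (* walks over the array of labels *)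
Local Notation rcnt := 5. (* clauses left *)
Local Notation rlit := 6.
Local Notation rvar := 7. (* index of the variable being eliminated *)
Local Notation rnum := 8. (* number of clauses *)
Local Notation rcls := 9. (* address of the first clause *)
Local Notation rlabs := 10. (* address of the array of labels *)
Local Notation rpos := 11. (* code of the positive literal *)
Local Notation rneg := 12. (* code of the negative literal *)
Local Notation rq := 13. (* current quantifier *)
Local Notation rP1 := 14. (* first live label among the positive occurrences *)
Local Notation rP2 := 15. (* last label among the positive occurrences *)
Local Notation rN1 := 16.
Local Notation rN2 := 17.
Local Notation rL := 18. (* current label *)
Local Notation rS := 19. (* literals left in the current clause *)
Local Notation rU := 20.
Local Notation rV := 21.
Local Notation rW := 22.
Local Notation rT := 23. (* new label *)

Definition mov d a := [:: IConst d 0; IAdd d d a].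
(** The absolute difference, zero exactly when the two contents agree: equality is thus reduced to
    the zero test of the machine. *)
Definition dist d a b u := [:: ISub d a b; ISub u b a; IAdd d d u].
(* The truncated subtraction [a - (a - b)] is the minimum of [a] and [b]. *)
Definition minimum d a b := [:: ISub d a b; ISub d a d].

Definition scan_literal : cmd :=
  block (ILoad rlit rptr :: dist rU rlit rpos rV) ;;
  If rU Skip (If rP1 Skip (block (mov rP1 rL)) ;; block (mov rP2 rL)) ;;
  block (dist rU rlit rneg rV) ;;
  If rU Skip (If rN1 Skip (block (mov rN1 rL)) ;; block (mov rN2 rL)) ;;
  block [:: IAdd rptr rptr rone; ISub rS rS rone].

Definition tracks (e : memory) (ps ns : seq nat) : Prop :=
  [/\ e rP1 = first_live ps, e rP2 = last 0 ps,
      e rN1 = first_live ns & e rN2 = last 0 ns].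

Lemma first_live_rcons s a :
  first_live (rcons s a) = if first_live s == 0 then a else first_live s.
Proof.
rewrite /first_live filter_rcons.
have: all (fun x => x != 0) [seq x <- s | x != 0] by apply: filter_all.
case: [seq x <- s | x != 0] => [|b t] /=; case: (eqVneq a 0) => //=.
  by move=> _ /andP[/negPf ->].
by move=> _ /andP[/negPf ->].
Qed.

Lemma scan_literal_spec v a l L ps ns e h :
  32 <= a -> e rptr = a -> h a = encode_lit l -> e rpos = 2 * v -> e rneg = 2 * v + 1 ->
  e rone = 1 -> e rL = L -> tracks e ps ns ->
  wp scan_literal (fun e' h' t =>
    [/\ h' = h, e' rptr = a.+1, e' rS = e rS - 1,
        tracks e' (ps ++ nseq (l == (v, true)) L) (ns ++ nseq (l == (v, false)) L) &
        frame [:: rlit; rU; rV; rP1; rP2; rN1; rN2; rptr; rS; rzero] e e' /\ t <= 40]) e h.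
Proof.
move=> a_ge ptrE litE posE negE oneE LE [p1 p2 n1 n2].
have lp : (encode_lit l - 2 * v + (2 * v - encode_lit l) == 0) = (l == (v, true)).
  by case: (l) => x b; rewrite /encode_lit xpair_eqE; case: b => /=; lia.
have ln : (encode_lit l - (2 * v + 1) + (2 * v + 1 - encode_lit l) == 0) = (l == (v, false)).
  by case: (l) => x b; rewrite /encode_lit xpair_eqE; case: b => /=; lia.
apply: wp_Seq; apply: wp_block_cons; first by rewrite /= ptrE.
rewrite /= ; steps; apply: wp_Skip => /=.

rewrite ptrE litE posE.
(* One assertion covers all branches, so that the test for the negative literal is verified only
   once. *)
apply: wp_Seq; apply: (@wp_conseq _ (fun e' h' t =>
  [/\ h' = h, tracks e' (ps ++ nseq (l == (v, true)) L) ns,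
    e' rlit = encode_lit l, frame [:: rlit; rU; rV; rP1; rP2; rzero] e e' & t <= 12])).
  apply: wp_If => /=; rewrite lp => lv.
    apply: wp_Skip; rewrite (negPf lv) cats0; split=> //; first by framed.
  rewrite lv /= cats1; apply: wp_Seq; apply: wp_If => /=; rewrite p1 => p0.
    apply: wp_Skip; steps; apply: wp_Skip; split=> //; last by framed.
    by split; rewrite /= ?first_live_rcons ?last_rcons ?(negPf p0) ?LE.
  steps; apply: wp_Skip; steps; apply: wp_Skip; split=> //; last by framed.
  by split; rewrite /= ?first_live_rcons ?last_rcons ?p0 ?LE.
move=> e1 h1 t1 [-> [{}p1 {}p2 {}n1 {}n2] lit1 fr1 t1_le].
apply: wp_Seq; steps; apply: wp_Skip => /=.
rewrite lit1 (fr1 12) // negE.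
apply: wp_Seq; apply: (@wp_conseq _ (fun e' h' t =>
  [/\ h' = h, tracks e' (ps ++ nseq (l == (v, true)) L) (ns ++ nseq (l == (v, false)) L),
    frame [:: rlit; rU; rV; rP1; rP2; rN1; rN2; rzero] e e' & t <= 12])).
  have fr : frame [:: rlit; rU; rV; rP1; rP2; rN1; rN2; rzero] e e1 by exact: frame_weaken fr1 _.
  apply: wp_If => /=; rewrite ln => lv.
    apply: wp_Skip; rewrite (negPf lv) cats0; split=> //.
    by apply: frame_trans fr (_ : frame [:: rU; rV; rN1; rN2; rzero] _ _) _; [framed|].
  rewrite lv /= cats1; apply: wp_Seq; apply: wp_If => /=; rewrite n1 => n0.
    apply: wp_Skip; steps; apply: wp_Skip; split=> //.
      by split; rewrite /= ?first_live_rcons ?last_rcons ?(negPf n0) ?(fr rL isT) ?LE.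
    by apply: frame_trans fr (_ : frame [:: rU; rV; rN1; rN2; rzero] _ _) _; [framed|].
  steps; apply: wp_Skip; steps; apply: wp_Skip; split=> //.
    by split; rewrite /= ?first_live_rcons ?last_rcons ?n0 ?(fr rL isT) ?LE.
  by apply: frame_trans fr (_ : frame [:: rU; rV; rN1; rN2; rzero] _ _) _; [framed|].
move=> e2 h2 t2 [-> [{}p1 {}p2 {}n1 {}n2] fr2 t2_le].
steps; apply: wp_Skip; split=> //=.
- by rewrite !fr2 // ptrE oneE addn1.
- by rewrite !fr2 // oneE.
- split; last by lia.
  by apply: frame_trans fr2 (_ : frame [:: rptr; rS] _ _) _; [framed|].
Qed.

(** * Arrays in memory and the scan of the clauses *)

Fixpoint holds (h : memory) (a : nat) (s : seq nat) : Prop :=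
  if s is x :: s' then h a = x /\ holds h a.+1 s' else True.

Lemma holds_cat h a s1 s2 :
  holds h a (s1 ++ s2) <-> holds h a s1 /\ holds h (a + size s1) s2.
Proof.
elim: s1 a => [|x s1 IH] a /=; first by rewrite addn0; split=> [|[]].
by rewrite IH addSnnS; tauto.
Qed.

Lemma holdsP h a s : (forall j, j < size s -> h (a + j) = nth 0 s j) <-> holds h a s.
Proof.
elim: s a => [|x s IH] a //=; split.
  move=> H; split; first by have /= <- := H 0 isT; rewrite addn0.
  by apply/IH => j lt_j; rewrite addSnnS H.
move=> [hx /IH H] [|j] lt_j; first by rewrite addn0.
by rewrite -addSnnS H.
Qed.

Lemma eq_holds h h' a s :
  (forall i, a <= i < a + size s -> h' i = h i) -> holds h a s -> holds h' a s.
Proof.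
by move=> hh /holdsP H; apply/holdsP => j lt_j; rewrite hh ?H //; lia.
Qed.

(** Each literal costs at most 40 steps for the body and 3 for the loop; the final test adds 1. *)
Lemma scan_literals_spec v (C : clause) a L ps ns e h :
  32 <= a -> e rptr = a -> holds h a (map encode_lit C) -> e rS = size C ->
  e rpos = 2 * v -> e rneg = 2 * v + 1 -> e rone = 1 -> e rL = L -> tracks e ps ns ->
  wp (While rS scan_literal) (fun e' h' t =>
    [/\ h' = h, e' rptr = a + size C,
        tracks e' (ps ++ nseq (count_mem (v, true) C) L)
                  (ns ++ nseq (count_mem (v, false) C) L),
        frame [:: rlit; rU; rV; rP1; rP2; rN1; rN2; rptr; rS; rzero] e e' &
        t <= 43 * size C + 1]) e h.
Proof.
elim: C a ps ns e => [|l C IH] a ps ns e a_ge ptrE /=.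
  by move=> _ SE *; apply: wp_While0; rewrite // !cats0 addn0; split.
move=> [litE hC] SE posE negE oneE LE tr.
apply: wp_WhileS; first by rewrite SE.
apply: wp_conseq (scan_literal_spec a_ge ptrE litE posE negE oneE LE tr) _.
move=> e1 h1 t1 [-> ptr1 S1 tr1 [fr1 t1_le]].
have fr1' : frame [:: rlit; rU; rV; rP1; rP2; rN1; rN2; rptr; rS; rzero] e (upd e1 rzero 0).
  by apply: frame_trans fr1 (_ : frame [:: rzero] _ _) _; [framed|].
apply: wp_conseq.
  apply: (IH a.+1 _ _ (upd e1 rzero 0)); last exact: tr1.
  all: try solve [exact: ptr1 | by rewrite ?fr1'].
    by apply: leq_trans a_ge _.
  by rewrite /= S1 SE subn1.
move=> e2 h2 t2 [-> ptr2 tr2 fr2 t2_le]; split=> //; last by lia.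
- by rewrite ptr2 addSnnS.
- by move: tr2; rewrite -!catA !cat_nseq /ncons -!iterD.
- exact: frame_trans fr1' fr2 _.
Qed.

Definition scan_clause : cmd :=
  block [:: ILoad rL rlab; ILoad rS rptr; IAdd rptr rptr rone] ;;
  While rS scan_literal ;;
  block [:: IAdd rlab rlab rone; ISub rcnt rcnt rone].

Definition encode_clauses (phi : cnf) : seq nat :=
  flatten [seq size C :: map encode_lit C | C <- phi].

(** The word holding the length of a clause pays for the fixed cost of that clause, which keeps the
    bound linear in the length of the encoding. *)
Lemma scan_clauses_spec v (phi : cnf) labels a b ps ns e h :
  32 <= a -> 32 <= b -> size labels = size phi ->
  e rptr = a -> holds h a (encode_clauses phi) ->
  e rlab = b -> holds h b labels -> e rcnt = size phi ->
  e rpos = 2 * v -> e rneg = 2 * v + 1 -> e rone = 1 -> tracks e ps ns ->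
  wp (While rcnt scan_clause) (fun e' h' t =>
    [/\ h' = h,
        tracks e' (ps ++ occurrences (v, true) (zip phi labels))
                  (ns ++ occurrences (v, false) (zip phi labels)),
        frame [:: rlit; rU; rV; rP1; rP2; rN1; rN2; rptr; rS; rL; rlab; rcnt; rzero] e e' &
        t <= 43 * size (encode_clauses phi) + 1]) e h.
Proof.
elim: phi labels a b ps ns e => [|C phi IH] [|L labels] a b ps ns e a_ge b_ge //=.
  by move=> _ ptrE _ labE _ cntE *; apply: wp_While0; rewrite // !cats0; split.
move=> [szE] ptrE [hC /holds_cat[hlits hphi]] labE [hL hlabels] cntE posE negE oneE tr.
apply: wp_WhileS; first by rewrite cntE.
apply: wp_Seq; apply: wp_block_cons; first by rewrite /= labE.
apply: wp_block_cons; first by rewrite /= ptrE.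
steps; apply: wp_Skip; rewrite labE ptrE hL hC oneE addn1.
set e1 := upd _ _ _.
have fr1 : frame [:: rL; rS; rptr] e e1 by framed.
apply: wp_Seq; apply: wp_conseq.
  apply: (@scan_literals_spec v C a.+1 L ps ns e1) => //; first exact: leqW.
  by rewrite /e1 /= ?addn1.
move=> e2 h2 t2 [-> ptr2 tr2 fr2 t2_le].
steps; apply: wp_Skip => /=.
rewrite !(fr2 rlab isT, fr2 rcnt isT, fr2 rone isT) !(fr1 rlab isT, fr1 rcnt isT, fr1 rone isT).
rewrite oneE labE cntE subn1 addn1 /=.
set e3 := upd _ _ _.
have fr3 : frame [:: rlit; rU; rV; rP1; rP2; rN1; rN2; rptr; rS; rL; rlab; rcnt; rzero] e e3.
  apply: (frame_trans fr1); first apply: frame_trans fr2 (_ : frame [:: rlab; rcnt; rzero] e2 e3) _.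
  - by framed.
  - by instantiate (1 := [:: rlit; rU; rV; rP1; rP2; rN1; rN2; rptr; rS; rlab; rcnt; rzero]).
  - by [].
apply: wp_conseq.
  apply: (IH labels (a.+1 + size C) b.+1 _ _ e3); last exact: tr2.
  all: try solve [done | by rewrite fr3 | by lia].
  by rewrite -(size_map encode_lit C).
move=> e4 h4 t4 [-> tr4 fr4 t4_le]; split=> //.
- by move: tr4; rewrite /occurrences /= !catA.
- exact: frame_trans fr3 fr4 _.
- by rewrite size_cat size_map -/(encode_clauses phi); lia.
Qed.

(** * Choosing the new label and relabelling *)

Definition choose_target : cmd :=
  block (IConst rT 0 :: dist rU rP1 rP2 rV ++ dist rW rN1 rN2 rV ++ [:: IAdd rU rU rW]) ;;
  If rq
    (If rU Skip
      (If rP1 (block (dist rU rP1 rN1 rV) ;; If rU (block (mov rT rN1)) Skip) Skip))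
    Skip.

Lemma dist_eq0 a b : (a - b + (b - a) == 0) = (a == b).
Proof. lia. Qed.

Lemma min_eq0 a b : (a - (a - b) == 0) = (a == 0) || (b == 0).
Proof. lia. Qed.

Lemma choose_target_spec q p1 p2 n1 n2 e h :
  e rq = nat_of_bool q -> e rP1 = p1 -> e rP2 = p2 -> e rN1 = n1 -> e rN2 = n2 ->
  wp choose_target (fun e' h' t =>
    [/\ h' = h, e' rT = target q p1 p2 n1 n2,
        frame [:: rU; rV; rW; rT; rzero] e e' & t <= 30]) e h.
Proof.
move=> qE p1E p2E n1E n2E.
apply: wp_Seq; steps; apply: wp_Skip => /=; rewrite p1E p2E n1E n2E.
rewrite /target; apply: wp_If => /=; rewrite qE => q0; last first.
  by apply: wp_Skip; split=> //; [case: q q0 {qE}| framed].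
have -> : q by case: q q0 {qE}.
(* A sum of distances vanishes iff both pairs agree, so one register tests two equalities. *)
have dE : (p1 - p2 + (p2 - p1) + (n1 - n2 + (n2 - n1)) == 0) = (p1 == p2) && (n1 == n2).
  by lia.
apply: wp_If => /=; rewrite dE => d0.
  by apply: wp_Skip; split=> //; [rewrite andbA (negPf d0)| framed].
rewrite andbA d0 /=.
apply: wp_If => /=; rewrite p1E => p0; last first.
  by apply: wp_Skip; split=> //; [rewrite p0 | framed].
rewrite p0 /=; apply: wp_Seq; steps; apply: wp_Skip => /=; rewrite p1E n1E.
apply: wp_If => /=; rewrite dist_eq0 => pn.
  by steps; apply: wp_Skip; split=> //=; [rewrite pn n1E | framed].
by apply: wp_Skip; split=> //=; [rewrite pn | framed].
Qed.

(** Zero stands for true: a minimum computes a disjunction and a sum a conjunction, so [rU] ends up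
    zero exactly on the labels satisfying [hit]. *)
Definition relabel_one : cmd :=
  block (ILoad rL rlab ::
    dist rU rL rP1 rV ++ dist rW rL rP2 rV ++ minimum rV rU rW ++
    dist rU rL rN1 rlit ++ dist rW rL rN2 rlit ++ minimum rlit rU rW) ;;
  If rq (block (minimum rU rV rlit)) (block [:: IAdd rU rV rlit]) ;;
  If rU Skip (block [:: IStore rlab rT]) ;;
  block [:: IAdd rlab rlab rone; ISub rcnt rcnt rone].

Lemma relabel_one_spec q p1 p2 n1 n2 T a b e h :
  32 <= b -> e rlab = b -> h b = a -> e rone = 1 ->
  e rq = nat_of_bool q -> e rP1 = p1 -> e rP2 = p2 -> e rN1 = n1 -> e rN2 = n2 ->
  e rT = T ->
  wp relabel_one (fun e' h' t =>
    [/\ h' b = (if hit q p1 p2 n1 n2 a then T else a),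
        forall i, i != b -> h' i = h i,
        e' rlab = b.+1, e' rcnt = e rcnt - 1 &
        frame [:: rL; rU; rV; rW; rlit; rlab; rcnt; rzero] e e' /\ t <= 40]) e h.
Proof.
move=> b_ge labE hb oneE qE p1E p2E n1E n2E TE.
apply: wp_Seq; apply: wp_block_cons; first by rewrite /= labE.
rewrite /=; steps; apply: wp_Skip => /=; rewrite labE hb p1E p2E n1E n2E.
apply: wp_Seq; apply: (@wp_conseq _ (fun e' h' t =>
    [/\ h' = h, (e' rU == 0) = hit q p1 p2 n1 n2 a, e' rL = a,
        frame [:: rL; rU; rV; rW; rlit; rzero] e e' & t <= 5])).
  rewrite /hit; apply: wp_If => /=; rewrite qE => q0; steps; apply: wp_Skip; split=> //=.
  - by case: q q0 {qE} => // _; rewrite !min_eq0 !dist_eq0 !inE.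
  - by framed.
  - by case: q q0 {qE} => // _; rewrite addn_eq0 !min_eq0 !dist_eq0 !inE.
  - by framed.
move=> e1 h1 t1 [-> UE LE fr1 t1_le].
apply: wp_Seq; apply: (@wp_conseq _ (fun e' h' t =>
    [/\ h' b = (if hit q p1 p2 n1 n2 a then T else a),
        forall i, i != b -> h' i = h i,
        frame [:: rL; rU; rV; rW; rlit; rzero] e e' & t <= 5])).
  apply: wp_If => /=; rewrite UE => ht.
    apply: wp_Skip; rewrite (negPf ht); split=> //.
    by apply: frame_trans fr1 (_ : frame [:: rzero] _ _) _; [framed|].
  apply: wp_block_cons; first by rewrite /= fr1 // labE.
  apply: wp_Skip; rewrite ht /= fr1 // labE fr1 // TE; split=> //.
    by rewrite /= eqxx.
  by move=> i /negPf ib; rewrite /= ib.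
move=> e2 h2 t2 [hb2 hi2 fr2 t2_le].
steps; apply: wp_Skip; split=> //=.
- by rewrite !fr2 // labE oneE addn1.
- by rewrite !fr2 // oneE.
- split; last by lia.
  by apply: frame_trans fr2 (_ : frame [:: rlab; rcnt] _ _) _; [framed|].
Qed.

(** Overwriting in place is safe: the labels compared against and the new label sit in registers
    fixed before the loop. *)
Lemma relabel_spec q p1 p2 n1 n2 labels b e h :
  32 <= b -> e rlab = b -> holds h b labels -> e rcnt = size labels -> e rone = 1 ->
  e rq = nat_of_bool q -> e rP1 = p1 -> e rP2 = p2 -> e rN1 = n1 -> e rN2 = n2 ->
  e rT = target q p1 p2 n1 n2 ->
  wp (While rcnt relabel_one) (fun e' h' t =>
    [/\ holds h' b (relabel q p1 p2 n1 n2 labels),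
        forall i, i < b \/ b + size labels <= i -> h' i = h i,
        frame [:: rL; rU; rV; rW; rlit; rlab; rcnt; rzero] e e' &
        t <= 43 * size labels + 1]) e h.
Proof.
elim: labels b e h => [|a labels IH] b e h b_ge labE /=.
  by move=> _ cntE *; apply: wp_While0.
move=> [ha hlabels] cntE oneE qE p1E p2E n1E n2E TE.
apply: wp_WhileS; first by rewrite cntE.
apply: wp_conseq (relabel_one_spec b_ge labE ha oneE qE p1E p2E n1E n2E TE) _.
move=> e1 h1 t1 [hb1 hi1 lab1 cnt1 [fr1 t1_le]].
have fr1' : frame [:: rL; rU; rV; rW; rlit; rlab; rcnt; rzero] e (upd e1 rzero 0).
  by apply: frame_trans fr1 (_ : frame [:: rzero] _ _) _; [framed|].
apply: wp_conseq.
  apply: (IH b.+1) => //; try by rewrite fr1'.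
  - by apply: leq_trans b_ge _.
  - by apply: eq_holds hlabels => i lt_i; apply: hi1; lia.
  - by rewrite /= cnt1 cntE subn1.
move=> e2 h2 t2 [hl2 hi2 fr2 t2_le]; split.
- by split=> //; rewrite hi2 //; left.
- by move=> i out; rewrite hi2 ?hi1 //; lia.
- exact: frame_trans fr1' fr2 _.
- by lia.
Qed.

Definition rewind : seq instr := mov rlab rlabs ++ mov rcnt rnum.

(** The index is decremented first, so the variables are treated from the last to the first. The
    quantifier lies one word beyond its index because the input starts with the number of
    variables. *)
Definition eliminate_one : cmd :=
  block ([:: ISub rvar rvar rone; IAdd rpos rvar rvar; IAdd rneg rpos rone;
             IAdd rU rbase rvar; IAdd rU rU rone; ILoad rq rU;
             IConst rP1 0; IConst rP2 0; IConst rN1 0; IConst rN2 0] ++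
         mov rptr rcls ++ rewind) ;;
  While rcnt scan_clause ;;
  choose_target ;;
  block rewind ;;
  While rcnt relabel_one.

Lemma size_encode_clauses (phi : cnf) :
  size (encode_clauses phi) = size phi + sumn (map size phi).
Proof.
elim: phi => //= C phi IH.
by rewrite /encode_clauses /= size_cat size_map -/(encode_clauses phi) IH; lia.
Qed.

Lemma size_encode_clauses_ge (phi : cnf) : size phi <= size (encode_clauses phi).
Proof. by rewrite size_encode_clauses leq_addr. Qed.

(** * Correctness and cost of the elimination loop and of the final test *)

Section Correctness.

Variables (qs : seq bool) (phi : cnf) (A : nat) (w : seq nat).
Hypotheses (wE : w = encode qs phi) (A_ge : 32 <= A) (w_lt : size w < A).

(** The input is copied to [A] and the labels start at [A + A], disjoint from it since [size w < A].
    The clauses follow the two counts and the quantifiers, hence the offset [(size qs).+2]. *)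
Definition ready (labels : seq nat) (k : nat) (e h : memory) : Prop :=
  [/\ [/\ e rone = 1, e rbase = A, e rnum = size phi,
          e rcls = A + (size qs).+2 & e rlabs = A + A],
      e rvar = k, holds h A w, holds h (A + A) labels & size labels = size phi].

Lemma size_encode : size w = (size qs + size (encode_clauses phi)).+2.
Proof. by rewrite wE /encode /= size_cat size_map /= addnS. Qed.

Lemma holds_encode h : holds h A w ->
  [/\ h A = size qs,
      forall i, i < size qs -> h (A + i).+1 = nat_of_bool (nth false qs i),
      h (A + (size qs).+1) = size phi &
      holds h (A + (size qs).+2) (encode_clauses phi)].
Proof.
rewrite wE /encode; case=> hA /holds_cat[/holdsP hq []].
rewrite size_map addSnnS => hm hc; split=> //.
  by move=> i lt_i; rewrite -addSn hq ?size_map // (nth_map false).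
by rewrite addnS.
Qed.

Lemma eliminate_one_spec labels k e h :
  ready labels k.+1 e h -> k < size qs ->
  wp eliminate_one (fun e' h' t =>
    ready (eliminate phi k (nth false qs k) labels) k e' h' /\ t <= 200 * size w) e h.
Proof.
case=> -[oneE baseE numE clsE labsE] varE hw hl szl lt_k.
have [_ hq _ hcls] := holds_encode hw.
have [szw szp] := (size_encode, size_encode_clauses_ge phi).
apply: wp_Seq; steps.
apply: wp_block_cons; first by rewrite /= baseE; lia.
rewrite /=; steps; apply: wp_Skip => /=.
rewrite baseE varE oneE clsE labsE numE subn1 /= !addn1 hq // !add0n.
set e1 := upd _ _ _.
have fr1 : frame [:: rvar; rpos; rneg; rU; rq; rP1; rP2; rN1; rN2; rptr; rlab; rcnt] e e1 by framed.
apply: wp_Seq; apply: wp_conseq.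
  apply: (@scan_clauses_spec k phi labels (A + (size qs).+2) (A + A) [::] [::] e1).
  all: try solve [done | by lia | by rewrite fr1 | by rewrite /e1 /=; lia].
rewrite !cat0s; set ps := occurrences _ _; set ns := occurrences _ _.
move=> e2 h2 t2 [-> [p1 p2 n1 n2] fr2 t2_le].
have q2 : e2 rq = nat_of_bool (nth false qs k) by rewrite fr2.
apply: wp_Seq; apply: wp_conseq (choose_target_spec h q2 p1 p2 n1 n2) _.
move=> e3 h3 t3 [-> TE fr3 t3_le].
apply: wp_Seq; steps; apply: wp_Skip; rewrite /= !add0n.
set e4 := upd _ _ _.
have fr4 : frame [:: rlab; rcnt] e3 e4 by framed.
have fr24 : frame [:: rU; rV; rW; rT; rlab; rcnt; rzero] e2 e4 by exact: frame_trans fr3 fr4 _.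
have fr14 : frame [:: rlit; rU; rV; rW; rT; rP1; rP2; rN1; rN2; rptr; rS; rL; rlab;
    rcnt; rzero] e1 e4.
  exact: frame_trans fr2 fr24 _.
have fr04 : frame [:: rlit; rU; rV; rW; rT; rP1; rP2; rN1; rN2; rptr; rS; rL; rlab; rcnt; rzero;
    rvar; rpos; rneg; rq] e e4.
  exact: frame_trans fr1 fr14 _.
apply: wp_conseq.
  apply: (@relabel_spec (nth false qs k) (first_live ps) (last 0 ps)
    (first_live ns) (last 0 ns) labels (A + A) e4 h).
  all: try solve [done | by lia | by rewrite fr04 | by rewrite fr24 // fr2
    | by rewrite fr24 | by rewrite fr4].
  - by rewrite /e4 /= fr3 // fr2.
  - by rewrite /e4 /= fr3 // fr2 // szl.
move=> e5 h5 t5 [hl5 hi5 fr5 t5_le]; split; last by lia.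
split; last by rewrite size_eliminate.
- by split; rewrite fr5 // fr04.
- by rewrite fr5 // fr14.
(* Relabelling writes only from [A + A] on, beyond the copied input. *)
- by apply: eq_holds hw => i lt_i; apply: hi5; lia.
- exact: hl5.
Qed.

Lemma eliminate_all_spec labels k e h :
  ready labels k e h -> k <= size qs ->
  wp (While rvar eliminate_one) (fun e' h' t =>
    ready (eliminate_below phi qs k labels) 0 e' h' /\
    t <= k * (200 * size w + 3) + 1) e h.
Proof.
elim: k labels e h => [|k IH] labels e h re lt_k.
  by have [_ var0 _ _ _] := re; apply: wp_While0.
apply: wp_WhileS; first by have [_ ->] := re.
apply: wp_conseq (eliminate_one_spec re lt_k) _ => e1 h1 t1 [re1 t1_le].
have re1' : ready (eliminate phi k (nth false qs k) labels) k (upd e1 rzero 0) h1.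
  by case: re1 => -[? ? ? ? ?] ? ? ? ?; split=> //; split.
apply: wp_conseq (IH _ _ _ re1' (ltnW lt_k)) _.
by move=> e2 h2 t2 [re2 t2_le]; split=> //; lia.
Qed.

Definition check_labels : cmd :=
  block (rewind ++ [:: IConst 0 1]) ;;
  While rcnt (block [:: ILoad rL rlab] ;; If rL (block [:: IConst 0 0]) Skip ;;
              block [:: IAdd rlab rlab rone; ISub rcnt rcnt rone]).

Lemma check_labels_spec labels e h : ready labels 0 e h ->
  wp check_labels (fun e' h' t =>
    e' 0 = nat_of_bool (all (pred1 0) labels) /\ t <= 20 * size w) e h.
Proof.
case=> -[oneE baseE numE clsE labsE] _ _ hl szl.
have [szw szp] := (size_encode, size_encode_clauses_ge phi).
apply: wp_Seq; steps; apply: wp_Skip; rewrite /= labsE numE !add0n.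
set e1 := upd _ _ _.
have : e1 0 = nat_of_bool true by [].
have : e1 rone = 1 by [].
have : e1 rlab = A + A by [].
have : e1 rcnt = size phi by [].
have : 32 <= A + A by lia.
(* The induction generalises over the position [b] and over the flag [c] accumulated in register
   0. *)
suff loop b c : 32 <= b -> e1 rcnt = size labels -> e1 rlab = b -> e1 rone = 1 ->
    e1 0 = nat_of_bool c -> holds h b labels ->
    wp (While rcnt (block [:: ILoad rL rlab] ;; If rL (block [:: IConst 0 0]) Skip ;;
              block [:: IAdd rlab rlab rone; ISub rcnt rcnt rone]))
      (fun e' h' t => e' 0 = nat_of_bool (c && all (pred1 0) labels) /\
         t <= 13 * size labels + 1) e1 h.
  move=> b_ge cnt1 lab1 one1 res1.
  apply: wp_conseq (loop _ true b_ge _ lab1 one1 res1 hl) _; first by rewrite szl.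
  by move=> e' h' t [-> t_le]; split=> //; lia.
move: {hl szl} e1 => e1.
elim: labels b c e1 => [|a labels IH] b c e1 b_ge cnt1 lab1 one1 res1 /=.
  by move=> _; apply: wp_While0; rewrite // andbT.
move=> [ha hl]; apply: wp_WhileS; first by rewrite cnt1.
apply: wp_Seq; apply: wp_block_cons; first by rewrite /= lab1.
rewrite /= lab1 ha; apply: wp_Skip; apply: wp_Seq.
apply: (@wp_conseq _ (fun e' h' t =>
    [/\ h' = h, e' 0 = nat_of_bool (c && (a == 0)),
        frame [:: 0; rL; rzero] e1 e' & t <= 4])).
  apply: wp_If => /= a0; steps; apply: wp_Skip; split=> //=; try by framed.
    by rewrite (negPf a0) andbF.
  by rewrite a0 andbT.
move=> e2 h2 t2 [-> res2 fr2 t2_le]; steps; apply: wp_Skip => /=.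
rewrite (fr2 rlab isT) (fr2 rcnt isT) (fr2 rone isT) lab1 cnt1 one1 subn1 !addn1 /=.
set e3 := upd _ _ _.
apply: wp_conseq.
  apply: (IH b.+1 (c && (a == 0)) e3).
  all: try solve [done | exact: leqW | by rewrite /e3 /= fr2].
by move=> e' h' t [-> t_le]; rewrite andbA; split=> //; lia.
Qed.

End Correctness.

(** * Initialisation: moving the input and numbering the clauses *)

(* The input occupies the registers from 1 on, so the program has no free
   register at first: doubling register 0, which holds the input length, yields
   an address beyond the input to which the low registers are moved. *)
Definition save_registers : seq instr :=
  nseq 5 (IAdd 0 0 0) ++ [:: IStore 0 1; IConst rone 1] ++
  flatten [seq [:: IAdd 0 0 rone; IStore 0 i] | i <- iota 2 30].

Definition copy_word : cmd :=
  block [:: ILoad rlit rptr; IStore rlab rlit; IAdd rptr rptr rone;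
            IAdd rlab rlab rone; ISub rcnt rcnt rone].

Definition label_clause : cmd :=
  block [:: IAdd rL rL rone; IStore rlab rL; IAdd rlab rlab rone; ISub rcnt rcnt rone].

(** [rbase] recovers [A] from register 0, which is left at [A + 30]. Registers below 32 are already
    saved, so copying resumes at address 32 with destination [A + 31]. *)
Definition setup : cmd :=
  block save_registers ;;
  block [:: IConst rbase 30; ISub rbase 0 rbase; IConst rptr 32;
            ISub rcnt rbase rptr; IAdd rlab 0 rone] ;;
  While rcnt copy_word ;;
  block ([:: ILoad rvar rbase; IAdd rU rbase rvar; IAdd rU rU rone; ILoad rnum rU;
            IAdd rcls rU rone; IAdd rlabs rbase rbase; IConst rL 0] ++ rewind) ;;
  While rcnt label_clause.

Definition solver : cmd := setup ;; While rvar eliminate_one ;; check_labels.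

(** Word [j] of the input sits in register [j.+1], so registers 1 to 31 hold words 0 to 30; past the
    end of a short input the default 0 is saved. *)
Lemma save_registers_spec w : 2 <= size w ->
  let A := 32 * size w in
  wp (block save_registers) (fun e h t =>
    [/\ e 0 = A + 30, e rone = 1,
        forall j, j < 31 -> h (A + j) = nth 0 w j,
        forall i, 32 <= i < A -> h i = nth 0 w i.-1 & t <= 67])
    (regs (init w)) (regs (init w)).
Proof.
move=> w_ge A; have A_ge : 64 <= A by rewrite /A; lia.
set M := regs (init w).
have ME i : 0 < i -> M i = nth 0 w i.-1 by case: i.
do 5!(apply: wp_block_cons; [done | rewrite /=]).
have -> : M 0 = size w by [].
(* Five doublings multiply the input length by 32. *)
set x := (X in upd _ 0 X); have {x}-> : x = A by rewrite /x /A; lia.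
apply: wp_block_cons; first by rewrite /=; lia.
apply: wp_block_cons => //.
set e1 := step_scratch _ _ _; set h1 := step_heap _ _ _.
(* Before register [k] is saved, register 0 points to the last word written, at [A + k - 2]. *)
have loop m k e h : k + m = 32 -> 2 <= k -> e 0 = A + k - 2 -> e rone = 1 ->
    (forall i, k <= i < 32 -> e i = nth 0 w i.-1) ->
    (forall j, j < k.-1 -> h (A + j) = nth 0 w j) ->
    (forall i, 32 <= i < A -> h i = nth 0 w i.-1) ->
    wp (block (flatten [seq [:: IAdd 0 0 rone; IStore 0 i] | i <- iota k m]))
      (fun e h t => [/\ e 0 = A + 30, e rone = 1,
        forall j, j < 31 -> h (A + j) = nth 0 w j,
        forall i, 32 <= i < A -> h i = nth 0 w i.-1 & t <= 2 * m]) e h.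
  elim: m k e h => [|m IH] k e h km k_ge e0 eone ei hj hi.
    apply: wp_Skip; split=> //; first by lia.
    by move=> j lt_j; apply: hj; lia.
  apply: wp_block_cons => //; apply: wp_block_cons; first by rewrite /= e0; lia.
  have k0 : (k == 0) = false by lia.
  rewrite /= k0 e0 eone; apply: wp_conseq; first apply: (IH k.+1) => //=; try by lia.
  - by move=> i lt_i; rewrite (_ : (i == 0) = false) ?ei //; lia.
  - move=> j lt_j; case: eqP => [jE|jn]; last by apply: hj; lia.
    by rewrite ei; [congr nth; lia | lia].
  - by move=> i lt_i; rewrite (_ : (i == _) = false) ?hi //; lia.
  by move=> e' h' t [? ? ? ? ?]; split=> //; lia.
apply: wp_conseq; first apply: (loop 30 2 e1 h1) => //.
- by rewrite /e1 /=; lia.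
- by move=> [|[|i]] // _; rewrite /e1 /= -ME.
- by case=> // _; rewrite /h1 /= addn0 eqxx.
- by move=> i lt_i; rewrite /h1 /= (_ : (i == A) = false) ?ME //; lia.
by move=> e h t [? ? ? ? ?]; split=> //; lia.
Qed.

(** Reads stay below [A] and writes above it, so they never interfere. Copying runs up to address
    [A - 1], possibly past the end of the input, where words read as 0. *)
Lemma copy_words_spec w A k e h : 64 <= A -> k + 32 <= A ->
  e rone = 1 -> e rbase = A -> e rcnt = k -> e rptr = A - k -> e rlab = A + A - k - 1 ->
  (forall j, j < A - k - 1 -> h (A + j) = nth 0 w j) ->
  (forall i, 32 <= i < A -> h i = nth 0 w i.-1) ->
  wp (While rcnt copy_word) (fun e' h' t =>
    [/\ forall j, j < A - 1 -> h' (A + j) = nth 0 w j,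
        e' rone = 1, e' rbase = A & t <= 8 * k + 1]) e h.
Proof.
move=> A_ge; elim: k e h => [|k IH] e h k_le oneE baseE cntE ptrE labE hj hi.
  by apply: wp_While0 => //; split=> // j lt_j; apply: hj; lia.
apply: wp_WhileS; first by rewrite cntE.
apply: wp_block_cons; first by rewrite /= ptrE; lia.
apply: wp_block_cons; first by rewrite /= labE; lia.
steps; apply: wp_Skip; rewrite /= ptrE labE oneE cntE hi; last by lia.
set e1 := upd _ _ _; set h1 := upd _ _ _.
apply: wp_conseq; first apply: (IH e1 h1); rewrite /e1 /=; try by lia.
- by move=> j lt_j; rewrite /h1 /=; case: eqP => [jE|jn]; [congr nth; lia | apply: hj; lia].
- by move=> i lt_i; rewrite /h1 /= (_ : (i == _) = false) ?hi //; lia.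
by move=> e' h' t [? ? ? ?]; split=> //; lia.
Qed.

Lemma label_clauses_spec m a b e h : 32 <= b ->
  e rone = 1 -> e rcnt = m -> e rL = a -> e rlab = b ->
  wp (While rcnt label_clause) (fun e' h' t =>
    [/\ holds h' b (iota a.+1 m), forall i, i < b -> h' i = h i,
        frame [:: rL; rlab; rcnt; rzero] e e' & t <= 7 * m + 1]) e h.
Proof.
elim: m a b e h => [|m IH] a b e h b_ge oneE cntE LE labE.
  by apply: wp_While0.
apply: wp_WhileS; first by rewrite cntE.
apply: wp_block_cons => //; apply: wp_block_cons; first by rewrite /= labE.
steps; apply: wp_Skip; rewrite /= labE LE oneE cntE !addn1 subn1 /=.
set e1 := upd _ _ _; set h1 := upd _ _ _.
have fr1 : frame [:: rL; rlab; rcnt; rzero] e e1 by framed.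
apply: wp_conseq; first apply: (IH a.+1 b.+1 e1 h1) => //; first exact: leqW.
move=> e2 h2 t2 [hl hi fr2 t2_le]; split=> //.
- by split=> //; rewrite hi // /h1 /= eqxx.
- by move=> i lt_i; rewrite hi ?/h1 /= ?(ltn_eqF lt_i) //; exact: leqW.
- exact: frame_trans fr1 fr2 _.
- by lia.
Qed.

Lemma setup_spec qs phi w : w = encode qs phi ->
  wp setup (fun e h t =>
    ready qs phi (32 * size w) w (iota 1 (size phi)) (size qs) e h /\ t <= 300 * size w)
    (regs (init w)) (regs (init w)).
Proof.
move=> wE; set A := 32 * size w; have AE : A = 32 * size w by [].
have szw := size_encode wE; have szp := size_encode_clauses_ge phi.
have w_ge : 2 <= size w by rewrite szw.
apply: wp_Seq; apply: wp_conseq (save_registers_spec w_ge) _.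
rewrite -/A; move: A AE => A AE; have A_ge : 64 <= A by lia.
move=> e1 h1 t1 [e0 oneE hj hi t1_le].
apply: wp_Seq; steps; apply: wp_Skip; rewrite /= e0 oneE addnK.
set e2 := upd _ _ _.
apply: wp_Seq; apply: wp_conseq.
  apply: (@copy_words_spec w A (A - 32) e2 h1) => //; try by rewrite /e2 /=; lia.
  by move=> j lt_j; apply: hj; lia.
move=> e3 h3 t3 [{}hj {}oneE baseE t3_le].
have hw : holds h3 A w by apply/holdsP => j lt_j; apply: hj; lia.
have [hA _ hm _] := holds_encode wE hw.
apply: wp_Seq; apply: wp_block_cons; first by rewrite /= baseE; lia.
steps; apply: wp_block_cons; first by rewrite /= baseE; lia.
rewrite /= baseE hA oneE !addn1 -addnS hm.
steps; apply: wp_Skip; rewrite /= baseE oneE !add0n addn1 -addnS.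
set e4 := upd _ _ _.
apply: wp_conseq.
  by apply: (@label_clauses_spec (size phi) 0 (A + A) e4 h3) => //; lia.
move=> e5 h5 t5 [hl hi5 fr5 t5_le]; split; last by lia.
split=> //; last by rewrite size_iota.
- by split; rewrite fr5.
- by rewrite fr5.
- by apply: eq_holds hw => i lt_i; apply: hi5; lia.
Qed.

Theorem theorem1 :
  exists (p : program) (c : nat),
    forall (qs : seq bool) (phi : cnf),
      wf_qbf qs phi ->
      (forall v, degree phi v <= 2) ->
      exists t : nat,
        t <= c * (qbf_size qs phi).+1 ^ 2 /\
        halted p (run p t (init (encode qs phi))) /\
        regs (run p t (init (encode qs phi))) 0 = nat_of_bool (satisfier_wins qs phi).
Proof.
(* With [N] the size of the formula, the encoding has length [N + 2]. Setup and final test cost at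
   most 320 steps per word, and each of at most [N] rounds 200 per word plus 3; 4000 leaves ample
   room. *)
exists (compile 0 solver), 4000 => qs phi wf deg.
set w := encode qs phi.
have wE : w = encode qs phi by [].
have szw := size_encode wE; have szp := size_encode_clauses_ge phi.
have [e [h [t [ex [resE t_le]]]]] : wp solver (fun e h t =>
    e 0 = nat_of_bool (satisfier_wins qs phi) /\
    t <= 320 * size w + (size qs * (200 * size w + 3) + 1))
    (regs (init w)) (regs (init w)).
  apply: wp_Seq; apply: wp_conseq (setup_spec wE) _ => e1 h1 t1 [re1 t1_le].
  have [A_ge A_lt] : 32 <= 32 * size w /\ size w < 32 * size w by lia.
  apply: wp_Seq.
  apply: wp_conseq (eliminate_all_spec wE A_ge A_lt re1 (leqnn _)) _ => e2 h2 t2 [re2 t2_le].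
  apply: wp_conseq (check_labels_spec wE A_ge A_lt re2) _ => e3 h3 t3 [-> t3_le].
  by rewrite satisfier_winsE //; split=> //; lia.
have code : code_at (compile 0 solver) 0 (compile 0 solver) by [].
(* The initial memory serves as both halves of the split state. *)
have mE : regs (init w) =1 join (regs (init w)) (regs (init w)).
  by move=> i; rewrite /join; case: ifP.
have [//|m runE m'E] := compile_correct ex _ code mE.
exists t; rewrite runE; split; last split.
- have szN : size w = qbf_size qs phi + 2 by rewrite szw size_encode_clauses /qbf_size; lia.
  have qN : size qs <= qbf_size qs phi by rewrite /qbf_size; lia.
  rewrite expnS expn1; nia.
(* Execution ends just past the last instruction, where the program counter acts as [IHalt]. *)
- by rewrite /halted /cur nth_default // size_compile.
- exact: etrans (m'E 0) resE.
Qed.
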